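(* For $x\neq 0$ let $T(x)=(t_{n,m})_{0\le m\le n}$ be the triangle generated by the infinite matrix $A(x)=(a_{ij})_{i,j\ge1}$ given by $$a_{ij}=\begin{cases}(j+1)x & \text{if } j\text{ is odd and } i\ge j-1,\\[1mm] \dfrac{j+2}{4x} & \text{if } j\text{ is even and } i=j-1,\\[1mm] 0&\text{otherwise,}\end{cases}$$ i.e. $$A(x)=\begin{pmatrix} 2x & \frac1x & 0 & 0 & 0 & 0 & \cdots\\ 2x & 0 & 4x & 0 & 0 & 0 & \cdots\\ 2x & 0 & 4x & \frac{3}{2x} & 0 & 0 & \cdots\\ 2x & 0 & 4x & 0 & 6x & 0 & \cdots\\ 2x & 0 & 4x & 0 & 6x & \frac{2}{x} & \cdots\\ \vdots & & & & & & \end{pmatrix}.$$ Then the first element $t_{n,0}$ of the $n$-th row of $T(x)$ is a polynomial $P_n(x)$ of degree $n$ such that $P_n(1)=(n+1)!$ and $$P_n(0)=\tan^{(n+1)}(0).$$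
   Context: Triangle generated by an infinite matrix: for an infinite matrix $A=(a_{ij})_{i,j\ge 1}$ let $A^{(n)}$ ($n\ge 1$) be the $n\times(n+1)$ submatrix formed by the first $n$ rows and the first $n+1$ columns. Put $t_{0,0}=1$ and define row vectors $\bar t_n=(t_{n,0},t_{n,1},\dots,t_{n,n})$ (the $n$-th row) by $\bar t_1=A^{(1)}$ and $\bar t_n=\bar t_{n-1}A^{(n)}=A^{(1)}A^{(2)}\cdots A^{(n)}$ for $n>1$. The array $(t_{n,m})_{0\le m\le n}$ is the triangle generated by $A$. $\tan^{(k)}(0)$ denotes the $k$-th derivative of the tangent function at $0$. *)

(* Defs.v *)
From HB Require Import structures.
From mathcomp Require Import all_boot all_order all_algebra.

Set Implicit Arguments.
Unset Strict Implicit.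
Unset Printing Implicit Defensive.

Import GRing.Theory.
Local Open Scope ring_scope.

(* An infinite matrix is a function [A : nat -> nat -> R] with rows and columns
   numbered from 1; values at an index 0 are never used.  Ordinals are numbered
   from 0, hence the shifts by one in [leading_mx]. *)
Definition leading_mx (R : Type) (A : nat -> nat -> R) (n : nat) :
    'M[R]_(n, n.+1) :=
  \matrix_(i < n, j < n.+1) A i.+1 j.+1.

(* Row n of the triangle has n + 1 entries t_{n,0}, ..., t_{n,n}. *)
Fixpoint triangle (R : pzRingType) (A : nat -> nat -> R) (n : nat) :
    'rV[R]_n.+1 :=
  match n with
  | 0 => const_mx 1
  | m.+1 => triangle A m *m leading_mx A m.+1
  end.

Lemma triangle1 (R : pzRingType) (A : nat -> nat -> R) :
  triangle A 1 = leading_mx A 1.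
Proof.
apply/matrixP=> i j; rewrite !mxE big_ord_recl big_ord0 !mxE addr0 mul1r.
by rewrite (ord1 i).
Qed.

Definition tan_mx (R : unitRingType) (x : R) (i j : nat) : R :=
  if odd j && (j.-1 <= i)%N then j.+1%:R * x
  else if ~~ odd j && (i == j.-1) then j.+2%:R / (4%:R * x)
  else 0.

(* Main.v *)
(** With [y' = 1 + 2 x y + y^2] and [y 0 = 0], differentiation along the
    solution maps [p(y) y'] to [(D p)(y) y'], where
    [D p = ((1 + 2 x y + y^2) p)'].  Put [e_k = y^k / k!], and let [b_0 = 1],
    [b_(2i+1) = 2 x D^i e_(i+1)],
    [b_(2i+2) = D^i ((i+3) e_(i+2) + 2 x e_(i+1))].  The identity
    [D e_(k+1) = e_k + 2 x (k+2) e_(k+1) + (k+2) (k+3) e_(k+2)] shows that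
    [A(x)] is the matrix of [D] in the basis [b]; hence
    [sum_m t_(n,m) b_m = D^n 1].  Since [D^i] lowers the order of vanishing at
    [0] by at most [i], only [b_0] has a nonzero constant term, so [t_(n,0)] is
    the constant term of [D^n 1].  For [x = 1], [D^n 1 = (n+1)! (1 + y)^n]; for
    [x = 0], the solution [y] is the tangent. *)
Require Import Defs.
From HB Require Import structures.
From mathcomp Require Import all_boot all_order all_algebra.
From mathcomp Require Import ring.
From mathcomp Require Import filter topology.
From mathcomp Require Import reals normedtype derive realfun trigo.

Import GRing.Theory Num.Theory.
Import numFieldNormedType.Exports.

Local Open Scope ring_scope.

(** * The operator and its action on coefficients *)

Definition riccati {S : comNzRingType} (a : S) (p : {poly S}) : {poly S} :=
  ((1 + (2 * a) *: 'X + 'X^2) * p)^`().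

Lemma riccati_is_linear (S : comNzRingType) (a : S) : linear (riccati a).
Proof. by move=> c p q; rewrite /riccati mulrDr -scalerAr derivD derivZ. Qed.

HB.instance Definition _ (S : comNzRingType) (a : S) :=
  GRing.isLinear.Build S {poly S} {poly S} _ (riccati a)
    (riccati_is_linear S a).

Definition iter_riccati {S : comNzRingType} (a : S) (n : nat) :
    {poly S} -> {poly S} :=
  iter n (riccati a).

Lemma iter_riccati_is_linear (S : comNzRingType) (a : S) n :
  linear (iter_riccati a n).
Proof.
move=> c p q; rewrite /iter_riccati.
by elim: n => //= n ->; rewrite linearP.
Qed.

HB.instance Definition _ (S : comNzRingType) (a : S) n :=
  GRing.isLinear.Build S {poly S} {poly S} _ (iter_riccati a n)
    (iter_riccati_is_linear S a n).

Lemma iter_riccatiS {S : comNzRingType} (a : S) n p :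
  iter_riccati a n.+1 p = riccati a (iter_riccati a n p).
Proof. by []. Qed.

Lemma iter_riccatiSr {S : comNzRingType} (a : S) n p :
  iter_riccati a n.+1 p = iter_riccati a n (riccati a p).
Proof. exact: iterSr. Qed.

Lemma coef_riccati {S : comNzRingType} (a : S) (p : {poly S}) (m : nat) :
  (riccati a p)`_m =
    (p`_m.+1 + 2 * a * p`_m + (if m is k.+1 then p`_k else 0)) *+ m.+1.
Proof.
rewrite coef_deriv 2!mulrDl mul1r -scalerAl !coefD coefZ coefXM coefXnM.
by case: m => [|m] //=; rewrite subn2.
Qed.

(** This allows iterating with an indeterminate parameter and specialising it afterwards. *)
Lemma map_riccati {S S' : comNzRingType} (f : {rmorphism S -> S'})
    (a : S) (p : {poly S}) :
  map_poly f (riccati a p) = riccati (f a) (map_poly f p).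
Proof.
rewrite /riccati -deriv_map rmorphM /= !rmorphD /= linearZ /= rmorph1.
by rewrite map_polyX map_polyXn rmorphM /= rmorph_nat.
Qed.

(** Coefficient [m] after one application involves no coefficient beyond [m.+1], so each application
    costs at most one order of vanishing. *)
Lemma riccati_low_coef {S : comNzRingType} (a : S) (p : {poly S})
    (i k m : nat) :
  (forall l, (l < k)%N -> p`_l = 0) -> (m + i < k)%N ->
  (iter_riccati a i p)`_m = 0.
Proof.
move=> p0; elim: i m => [|i IHi] m; first by rewrite addn0 => /p0.
rewrite addnS => mik; rewrite iter_riccatiS coef_riccati.
rewrite !IHi ?addSn //; last exact: ltnW.
rewrite mulr0 !add0r; case: m mik => [|m] mik; first by rewrite mul0rn.
by rewrite IHi ?mul0rn // (leq_trans _ mik) // !addSn ltnS ltnW.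
Qed.

Lemma riccati_Xn {S : comNzRingType} (a : S) (k : nat) :
  riccati a 'X^(k.+1) = k.+1%:R *: 'X^k + (2 * a * k.+2%:R) *: 'X^(k.+1)
                      + k.+3%:R *: 'X^(k.+2).
Proof.
rewrite /riccati 2!mulrDl mul1r -scalerAl -exprS -exprD.
rewrite !derivD derivZ !derivXn /=.
by rewrite -!scaler_nat !scalerA.
Qed.

(** * The basis and the matrix of the operator in it *)

Definition divided_power {F : fieldType} (k : nat) : {poly F} :=
  (k`!%:R)^-1 *: 'X^k.

Lemma coef_divided_power {F : fieldType} (k l : nat) :
  (l < k)%N -> (@divided_power F k)`_l = 0.
Proof. by move=> lk; rewrite coefZ coefXn ltn_eqF // mulr0. Qed.

Lemma riccati_divided_power {F : numFieldType} (a : F) (k : nat) :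
  riccati a (divided_power k.+1) =
    divided_power k + (2 * a * k.+2%:R) *: divided_power k.+1
    + (k.+3%:R * k.+2%:R) *: divided_power k.+2.
Proof.
have nz j : (j.+1%:R : F) != 0 by rewrite pnatr_eq0.
have fnz j : (j`!%:R : F) != 0 by rewrite pnatr_eq0 -lt0n fact_gt0.
rewrite linearZ /= riccati_Xn /divided_power !scalerDr !scalerA !factS !natrM.
congr (_ *: _ + _ *: _ + _ *: _).
- by rewrite invfM mulrAC mulVf // mul1r.
- by rewrite mulrC.
- by field; rewrite fnz nat1r -natrD !nz.
Qed.

Definition even_basis {F : fieldType} (x : F) (i : nat) : {poly F} :=
  if i is j.+1 then
    iter_riccati x j
      (j.+3%:R *: divided_power j.+2 + (2 * x) *: divided_power j.+1)
  else 1.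

Definition odd_basis {F : fieldType} (x : F) (i : nat) : {poly F} :=
  (2 * x) *: iter_riccati x i (divided_power i.+1).

Definition tan_basis {F : fieldType} (x : F) (k : nat) : {poly F} :=
  if odd k then odd_basis x k./2 else even_basis x k./2.

Lemma tan_basis_even {F : fieldType} (x : F) i :
  tan_basis x i.*2 = even_basis x i.
Proof. by rewrite /tan_basis odd_double doubleK. Qed.

Lemma tan_basis_odd {F : fieldType} (x : F) i :
  tan_basis x i.*2.+1 = odd_basis x i.
Proof. by rewrite /tan_basis /= odd_double /= uphalf_double. Qed.

Lemma tan_basis_coef0 {F : fieldType} (x : F) (k : nat) :
  (tan_basis x k)`_0 = (k == 0%N)%:R.
Proof.
rewrite -{1}(odd_double_half k); case ok : (odd k).
  rewrite tan_basis_odd coefZ (riccati_low_coef _ _ _ k./2.+1) ?mulr0 //.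
    by case: k ok.
  exact: coef_divided_power.
rewrite add0n tan_basis_even; case: k ok => [|[|k]] //= ok.
  by rewrite coef1.
(* The index is now [k.+2]: [k./2] iterations act on a polynomial vanishing to order [k./2.+1]. *)
rewrite (riccati_low_coef _ _ _ k./2.+1) // => l lk.
by rewrite coefD !(coefZ, coefXn) !ltn_eqF ?mulr0 ?addr0 // ltnW.
Qed.

(* An entry of an odd-numbered column of [A(x)] that is not zero does not depend
   on the row, hence one partial sum serves all rows. *)
Definition even_part {F : fieldType} (x : F) (N : nat) : {poly F} :=
  \sum_(m < N) (if odd m then 0 else (m.+2%:R * x) *: tan_basis x m).

Lemma even_part_odd_double {F : fieldType} (x : F) i :
  even_part x i.*2.+1 = even_part x i.*2 + (i.*2.+2%:R * x) *: even_basis x i.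
Proof. by rewrite /even_part big_ord_recr /= odd_double tan_basis_even. Qed.

Lemma even_part_double {F : fieldType} (x : F) i :
  even_part x i.+1.*2 = even_part x i.*2.+1.
Proof. by rewrite /even_part doubleS big_ord_recr /= odd_double /= addr0. Qed.

(** The sum telescopes: passing from [i] to [i.+1] adds a single even term. In the expansion of
    [riccati x (divided_power i.+2)], the term [divided_power i.+1] gives the previous image, and
    the other two combine into a multiple of [even_basis x i.+2]. *)
Lemma riccati_odd_basis {F : numFieldType} (x : F) (i : nat) :
  riccati x (odd_basis x i) = even_part x i.+1.*2.+1.
Proof.
elim: i => [|i IHi].
  have e0 : @divided_power F 0 = 1 by rewrite /divided_power invr1 scale1r.
  rewrite even_part_odd_double even_part_double even_part_odd_double.
  rewrite -[(0.*2.+2)%N]/2%N -[(1.*2.+2)%N]/4%N /even_part big_ord0 add0r.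
  rewrite /odd_basis /= linearZ /= riccati_divided_power e0.
  rewrite !scalerDr !scalerA -addrA [X in _ + X]addrC.
  by congr (_ *: _ + (_ *: _ + _ *: _)); ring.
rewrite even_part_odd_double even_part_double -IHi /odd_basis /even_basis.
apply/eqP; rewrite addrC -subr_eq; apply/eqP.
rewrite ![riccati x (_ *: _)]linearZ /= -iter_riccatiS iter_riccatiSr.
rewrite riccati_divided_power -scalerBr -!linearB /=.
rewrite -!addrA addrC !addrA subrK [_ *: _ + _ in LHS]addrC.
move: (divided_power i.+3) (divided_power i.+2) => e3 e2.
have -> : i.+2.*2.+2%:R * x = 2 * x * i.+3%:R.
  by rewrite -[i.+2.*2.+2]/(i.+3.*2)%N -muln2 natrM; ring.
rewrite -[RHS]scalerA; congr (_ *: _); rewrite -!linearZ /= scalerDr !scalerA.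
by congr (riccati _ (iter_riccati _ _ (_ *: _ + _ *: _))); ring.
Qed.

Lemma riccati_tan_basis {F : numFieldType} (x : F) (k : nat) : x != 0 ->
  riccati x (tan_basis x k) =
    \sum_(m < k.+2) tan_mx x k.+1 m.+1 *: tan_basis x m.
Proof.
(* The superdiagonal term is split off; in the remaining terms the even-numbered columns vanish. *)
move=> x0; rewrite big_ord_recr /=.
have -> : \sum_(m < k.+1) tan_mx x k.+1 m.+1 *: tan_basis x m
          = even_part x k.+1.
  apply: eq_bigr => m _; rewrite /tan_mx /= negbK.
  rewrite (leq_trans (ltnW (ltn_ord m))) // andbT gtn_eqF // andbF.
  by case: (odd m); rewrite /= ?scale0r.
rewrite -(odd_double_half k); case: (odd k).
  rewrite add1n tan_basis_odd riccati_odd_basis even_part_odd_double.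
  have -> : k./2.*2.+2 = k./2.+1.*2 by [].
  by rewrite tan_basis_even /tan_mx /= odd_double leqnn.
rewrite add0n tan_basis_even tan_basis_odd /tan_mx /= odd_double /= eqxx.
case: k./2 => [|i].
  have -> : even_part x 0.*2.+1 = (2 * x)%:P.
    by rewrite even_part_odd_double /even_part big_ord0 add0r -mul_polyC mulr1.
  rewrite /odd_basis /= /divided_power invr1 scale1r scalerA.
  rewrite -[(0.*2.+4)%N]/4%N (_ : _ / _ * _ = 2); last by field; rewrite ?x0.
  rewrite /riccati mulr1 !derivD derivZ derivX derivXn derivC add0r /=.
  by rewrite -mul_polyC mulr1 scaler_nat.
have -> : i.+1.*2.+4%:R / (4 * x) = i.+3%:R / (2 * x).
  have -> : i.+1.*2.+4%:R = 2 * i.+3%:R :> F.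
    by rewrite -[i.+1.*2.+4]/(i.+3.*2)%N -mul2n natrM.
  by field.
(* The denominator cancels the factor [2 * x] of [odd_basis]; the two terms left are the images of
   the two summands in [even_basis]. *)
rewrite -riccati_odd_basis scalerA divfK ?mulf_neq0 ?pnatr_eq0 //.
rewrite /odd_basis /even_basis iter_riccatiS [RHS]addrC.
move: (divided_power i.+2) (divided_power i.+1) => e2 e1.
by rewrite !linearD /= !linearZ.
Qed.

Lemma sum_triangle_tan_basis {F : numFieldType} (x : F) (n : nat) : x != 0 ->
  \sum_(m < n.+1) triangle (tan_mx x) n ord0 m *: tan_basis x m
    = iter_riccati x n 1.
Proof.
move=> x0; elim: n => [|n IHn].
  by rewrite big_ord1 mxE scale1r.
pose t k := triangle (tan_mx x) n ord0 k.
rewrite iter_riccatiS -IHn linear_sum /=.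
transitivity (\sum_(m < n.+2) \sum_(k < n.+1)
    (t k * tan_mx x k.+1 m.+1) *: tan_basis x m).
  apply: eq_bigr => m _; rewrite mxE scaler_suml.
  by apply: eq_bigr => k _; rewrite mxE.
rewrite exchange_big; apply: eq_bigr => k _ /=.
rewrite linearZ /= riccati_tan_basis // scaler_sumr.
(* Entries beyond the superdiagonal are zero, so every inner sum extends to the common length
   [n.+2]. *)
rewrite (big_ord_widen n.+2
  (fun m => t k *: (tan_mx x k.+1 m.+1 *: tan_basis x m)));
  last exact: (ltn_ord k).
rewrite [RHS]big_mkcond /=; apply: eq_bigr => m _.
case: ifP => [_|]; first by rewrite scalerA.
move/negbT; rewrite -leqNgt /tan_mx /= => km.
by rewrite leqNgt km andbF ltn_eqF // andbF mulr0 scale0r.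
Qed.

Lemma triangle_tan_mx0 {F : numFieldType} (x : F) (n : nat) : x != 0 ->
  triangle (tan_mx x) n ord0 ord0 = (iter_riccati x n 1)`_0.
Proof.
move=> x0; rewrite -sum_triangle_tan_basis // coef_sum big_ord_recl.
rewrite big1 => [|m _]; first by rewrite coefZ tan_basis_coef0 mulr1 addr0.
by rewrite coefZ tan_basis_coef0 mulr0.
Qed.

(** * The parameters 1 and 0 *)

Lemma iter_riccati1 {S : comNzRingType} (n : nat) :
  iter_riccati (1 : S) n 1 = (n.+1)`!%:R *: (1 + 'X) ^+ n.
Proof.
elim: n => [|n IHn]; first by rewrite scale1r.
rewrite iter_riccatiS IHn linearZ /= /riccati.
(* The quadratic is a perfect square here, so each step differentiates a power of [1 + 'X]. *)
have -> : 1 + (2 * 1) *: 'X + 'X^2 = (1 + 'X) ^+ 2 :> {poly S}.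
  by rewrite mulr1 scaler_nat; ring.
rewrite -exprD deriv_exp derivD derivX derivC add0r mul1r.
by rewrite -scaler_nat scalerA -natrM mulnC.
Qed.

Lemma derive1n_tan {R : realType} (n : nat) (z : R) : cos z != 0 ->
  derive1n n.+1 (@tan R) z = ((1 + 'X^2) * iter_riccati 0 n 1).[tan z].
Proof.
elim: n z => [|n IHn] z cz.
  rewrite derive1n1 derive1E.
  have /@derive_val -> := is_derive_tan cz.
  by rewrite mulr1 !hornerE cos2_tan2.
rewrite derive1nS derive1E.
(* Differentiating the induction hypothesis requires it on a neighbourhood of [z], where [cos] stays
   nonzero by continuity. *)
have near_tan : {near z, derive1n n.+1 (@tan R)
    =1 horner ((1 + 'X^2) * iter_riccati 0 n 1) \o tan}.
  have : \forall y \near z, cos y != 0.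
    exact: (@cvgr_neq0 _ R^o _ (nbhs z) _ cos _ (@continuous_cos R z) cz).
  by apply: filterS => y /IHn.
rewrite (near_eq_derive _ near_tan) //.
have tan' := is_derive_tan cz.
rewrite derive_val iter_riccatiS hornerM mulrC cos2_tan2 //.
by rewrite /riccati mulr0 scale0r addr0 !hornerE.
Qed.

(** * The degree in the parameter, and the conclusion *)

Lemma size_coef_iter_riccati {R : numDomainType} (n k : nat) :
  (size ((iter_riccati ('X : {poly R}) n 1)`_k)%R <= n.+1)%N.
Proof.
elim: n k => [|n IHn] k.
  by rewrite coef1; case: (k == 0%N); rewrite ?size_poly1 ?size_poly0.
rewrite iter_riccatiS coef_riccati -[X in polyseq X]scaler_nat.
apply: leq_trans (size_scale_leq _ _) _.
have size2X :
    (size (2 * 'X * (iter_riccati ('X : {poly R}) n 1)`_k)%R <= n.+2)%N.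
  rewrite -mulrA mulr_natl -[X in polyseq X]scaler_nat.
  apply: leq_trans (size_scale_leq _ _) _.
  by rewrite (leq_trans (size_polyMleq _ _)) // size_polyX add2n ltnS IHn.
apply: leq_trans (size_polyD _ _) _; rewrite geq_max.
apply/andP; split.
  apply: leq_trans (size_polyD _ _) _.
  by rewrite geq_max size2X (leq_trans (IHn _)).
by case: k {size2X} => [|k]; rewrite ?size_poly0 // (leq_trans (IHn _)).
Qed.

Lemma size_iter_riccati {R : numDomainType} (n : nat) :
  size (iter_riccati ('X : {poly R}) n 1)`_0 = n.+1.
Proof.
elim: n => [|n IHn]; first by rewrite coef1 size_poly1.
rewrite iter_riccatiS coef_riccati /= addr0 mulr1n.
(* This product has degree [n.+1], while the other summand, coefficient 1, has degree at most [n];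
   no cancellation can occur. *)
have sizeX : size (2 * 'X * (iter_riccati ('X : {poly R}) n 1)`_0) = n.+2.
  rewrite -mulrA mulr_natl -[X in polyseq X]scaler_nat size_scale ?pnatr_eq0 //.
  by rewrite mulrC size_mulX ?IHn // -size_poly_eq0 IHn.
by rewrite addrC size_polyDl sizeX // ltnS size_coef_iter_riccati.
Qed.

Theorem theorem5p3 (R : realType) (n : nat) :
  exists P : {poly R},
    [/\ size P = n.+1,
        (forall x : R, x != 0 -> triangle (tan_mx x) n ord0 ord0 = P.[x]),
        P.[1] = (n.+1)`!%:R
      & P.[0] = derive1n n.+1 (@tan R) 0].
Proof.
have evalP (x : R) : ((iter_riccati 'X n 1)`_0).[x] = (iter_riccati x n 1)`_0.
  have <- : map_poly (horner_eval x) (iter_riccati 'X n 1) = iter_riccati x n 1.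
    elim: n => [|m IHm]; first by rewrite rmorph1.
    by rewrite !iter_riccatiS map_riccati IHm /= /horner_eval hornerX.
  by rewrite coef_map.
(* Taking the indeterminate as parameter gives one polynomial for all [x], including 0, where the
   matrix itself has no meaning. *)
exists (iter_riccati 'X n 1)`_0; split.
- exact: size_iter_riccati.
- by move=> x x0; rewrite evalP triangle_tan_mx0.
- by rewrite evalP iter_riccati1 coefZ -horner_coef0 !hornerE expr1n mulr1.
(* Since [tan 0 = 0], the factor [1 + 'X^2] evaluates to 1 and only the constant term remains. *)
- rewrite evalP derive1n_tan ?cos0 ?oner_neq0 // tan0 !hornerE.
  by rewrite horner_coef0 expr0n addr0 mul1r.
Qed.
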